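(* Let $V$ be a countable set and let $\mathrm{CD}$ be the L-ADT on $V$ defined in the context. Any interval-linearizable implementation of $\mathrm{CD}$ (i.e., one all of whose histories are interval-linearizable with respect to the interval-sequential specification $\mathcal S_{\mathrm{CD}}$) is a conflict detector. That is, in each of its executions: (i) if no two $\mathit{check}$ operations have different inputs, then no operation returns $\mathit{true}$; (ii) if two $\mathit{check}$ operations have different inputs, then they do not both return $\mathit{false}$.
   Context: **The type CD.** $\mathrm{CD}=(A,B,(Z,\sqsubseteq,\sqcup),z_0,\tau,\delta)$ with: inputs $A=\{\mathit{check}(v)\mid v\in V\}$; outputs $B=\{\mathit{true},\mathit{false}\}$; states $Z=V\cup\{\bot,\top\}$ with $\bot,\top\notin V$ distinct, partially ordered by $\bot\sqsubseteq v\sqsubseteq\top$ for $v\in V$, $\bot\sqsubseteq\top$, and distinct elements of $V$ incomparable; $\sqcup$ is the least upper bound; initial state $z_0=\bot$; transition function $\tau(z,\mathit{check}(v))=v$ if $z=\bot$ or $z=v$, and $\top$ otherwise; output function $\delta(z,\mathit{check}(v))=\mathit{true}$ if $z=\top$ and $\mathit{false}$ otherwise. **Interval-sequential specification.** An interval-sequential history is a sequence $z_0,I_1,R_1,z_1,\dots,I_m,R_m,z_m$ with states $z_i\in Z$, sets $I_i$ of inputs and $R_i$ of outputs, each labeled with a process and an operation identifier. $\mathcal S_{\mathrm{CD}}$ is the set of those (well-formed) interval-sequential histories such that, for all $i=1,\dots,m$: $z_i=\bigsqcup_{a\in I_i}\tau(z_{i-1},a)$ (with $z_i=z_{i-1}$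 if $I_i=\emptyset$), and every $r\in R_i$ equals $\delta(z_i,a)$, where $a$ is the invocation matching $r$. **Interval-linearizability.** Histories are sequences of labeled inputs and outputs. They are well-formed: a process invokes an operation only after its previous one has returned and every response is preceded by its matching invocation (in an interval-sequential history, the invocation matching a response in $R_i$ lies in some $I_j$ with $j\le i$). A history $H$ is interval-linearizable with respect to $\mathcal S$ if it can be completed (adding matching responses to incomplete operations) to a history $\bar H$ for which there is an interval-sequential history $S$ such that (1) $\bar H|p=S|p$ for every process $p$ (equal projections on $p$); (2) $S\in\mathcal S$; (3) $\rightarrow_H\subseteq\rightarrow_S$, where $\rightarrow$ is the real-time precedence relation on operations. *)

(* Defs.v *)
From HB Require Import structures.
From mathcomp Require Import all_boot all_order finmap.
Set Implicit Arguments.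
Unset Strict Implicit.
Unset Printing Implicit Defensive.
Import Order.TTheory.
Local Open Scope order_scope.

(* The data of an L-ADT (A, B, (Z, <=, join), z0, tau, delta). The bottom of Z
   is only used as the neutral element of finite joins. *)
Record ladt := LADT {
  ladt_in : choiceType;
  ladt_out : choiceType;
  ladt_disp : Order.disp_t;
  ladt_state : bJoinSemilatticeType ladt_disp;
  ladt_init : ladt_state;
  ladt_tau : ladt_state -> ladt_in -> ladt_state;
  ladt_delta : ladt_state -> ladt_in -> ladt_out }.

Section Histories.
Variables (P Id : choiceType) (A B : choiceType).

(* An operation is designated by its process and its operation identifier. *)
Definition label : Type := (P * Id)%type.
Definition invocation : Type := (label * A)%type.
Definition response : Type := (label * B)%type.
HB.instance Definition _ := Choice.on label.
HB.instance Definition _ := Choice.on invocation.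
HB.instance Definition _ := Choice.on response.

Definition event : Type := (invocation + response)%type.
HB.instance Definition _ := Choice.on event.

Definition history := seq event.

Definition inv_ev (l : label) (a : A) : event := inl (l, a).
Definition res_ev (l : label) (b : B) : event := inr (l, b).

Definition event_label (e : event) : label :=
  match e with inl i => i.1 | inr r => r.1 end.

Definition proj (p : P) (H : history) : history :=
  [seq e <- H | (event_label e).1 == p].

Definition inv_labels (H : history) : seq label :=
  pmap (fun e => if e is inl i then Some i.1 else None) H.

Definition res_labels (H : history) : seq label :=
  pmap (fun e => if e is inr r then Some r.1 else None) H.

(* Invocations and matching responses alternate; [pending] is the currently
   open operation, if any. A final invocation may remain without response. *)
Fixpoint alternating (pending : option label) (H : history) : bool :=
  match pending, H with
  | _, [::] => true
  | None, inl i :: H' => alternating (Some i.1) H'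
  | Some l, inr r :: H' => (r.1 == l) && alternating None H'
  | _, _ => false
  end.

Definition well_formed (H : history) : Prop :=
  uniq (inv_labels H) /\ forall p, alternating None (proj p H).

Definition complete (H : history) : Prop :=
  {subset inv_labels H <= res_labels H}.

(* [completion H H']: H' arises from H by adding responses to the incomplete
   operations of H, matching being enforced by the well-formedness of H'. *)
Definition completion (H H' : history) : Prop :=
  exists rs : seq response,
    [/\ H' = H ++ map inr rs, well_formed H' & complete H'].

(* Real-time precedence: the response of l1 occurs before the invocation
   of l2. *)
Definition precedes (H : history) (l1 l2 : label) : Prop :=
  exists b a H1 H2 H3, H = H1 ++ res_ev l1 b :: H2 ++ inv_ev l2 a :: H3.

End Histories.

Arguments inv_ev {P Id A B}.
Arguments res_ev {P Id A B}.

Section IntervalSequential.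
Variables (P Id : choiceType) (A B : choiceType) (Z : Type).

(* One block I_i, R_i, z_i of z_0, I_1, R_1, z_1, ..., I_m, R_m, z_m. *)
Record block := Block {
  block_inv : {fset invocation P Id A};
  block_res : {fset response P Id B};
  block_state : Z }.

Record iseq_history := ISeqHistory {
  iseq_init : Z;
  iseq_blocks : seq block }.

(* The i-th state z_i, for 0 <= i <= m. *)
Definition iseq_state (S : iseq_history) (i : nat) : Z :=
  nth (iseq_init S) (iseq_init S :: map block_state (iseq_blocks S)) i.

(* I_i and R_i, for 1 <= i <= m; both are empty for other indices. *)
Definition iseq_inv (S : iseq_history) (i : nat) : {fset invocation P Id A} :=
  nth fset0 (fset0 :: map block_inv (iseq_blocks S)) i.

Definition iseq_res (S : iseq_history) (i : nat) : {fset response P Id B} :=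
  nth fset0 (fset0 :: map block_res (iseq_blocks S)) i.

(* The sequence of events I_1, R_1, I_2, R_2, ... The order in which each set
   is enumerated does not affect well-formedness, nor real-time precedence;
   in a well-formed history each I_i and each R_i has at most one event of any
   given process, so it does not affect projections on processes either. *)
Definition iseq_events (S : iseq_history) : history P Id A B :=
  flatten [seq [seq inl i | i <- block_inv b] ++ [seq inr r | r <- block_res b]
          | b <- iseq_blocks S].

Definition iseq_well_formed (S : iseq_history) : Prop :=
  well_formed (iseq_events S).

Definition interval_linearizable
    (spec : iseq_history -> Prop) (H : history P Id A B) : Prop :=
  exists (H' : history P Id A B) (S : iseq_history),
    [/\ completion H H',
        forall p, proj p H' = proj p (iseq_events S),
        spec S
      & forall l1 l2, precedes H l1 l2 -> precedes (iseq_events S) l1 l2].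

End IntervalSequential.

Section Specification.
Variables (P Id : choiceType) (D : ladt).

Definition ladt_iseq_history :=
  iseq_history P Id (ladt_in D) (ladt_out D) (ladt_state D).

Definition next_state (z : ladt_state D)
    (I : {fset invocation P Id (ladt_in D)}) : ladt_state D :=
  if I == fset0 then z else \join_(x <- I) ladt_tau z x.2.

Definition iseq_spec (S : ladt_iseq_history) : Prop :=
  [/\ iseq_well_formed S,
      iseq_init S = ladt_init D
    & forall i, (1 <= i <= size (iseq_blocks S))%N ->
        iseq_state S i = next_state (iseq_state S i.-1) (iseq_inv S i) /\
        forall l b, (l, b) \in iseq_res S i ->
          exists a j, [/\ (j <= i)%N, (l, a) \in iseq_inv S j
                        & b = ladt_delta (iseq_state S i) a]].

(* An implementation, seen through the histories of its executions. *)
Record implementation := Implementation {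
  execution : Type;
  history_of : execution -> history P Id (ladt_in D) (ladt_out D);
  history_of_wf : forall e, well_formed (history_of e) }.

Definition interval_linearizable_impl (X : implementation) : Prop :=
  forall e : execution X, interval_linearizable iseq_spec (history_of e).

End Specification.

Section ConflictDetector.
Variable V : countType.

Inductive cd_in := check of V.

Definition checked (a : cd_in) : V := let: check v := a in v.
Lemma checkedK : cancel checked check. Proof. by case. Qed.
HB.instance Definition _ := Countable.copy cd_in (can_type checkedK).

Inductive cd_state := Bot | Val of V | Top.

Definition cd_code (z : cd_state) : option (option V) :=
  match z with Bot => None | Val v => Some (Some v) | Top => Some None end.
Definition cd_decode (x : option (option V)) : cd_state :=
  match x with None => Bot | Some (Some v) => Val v | Some None => Top end.
Lemma cd_codeK : cancel cd_code cd_decode. Proof. by case. Qed.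
HB.instance Definition _ := Countable.copy cd_state (can_type cd_codeK).

Definition cd_le (z1 z2 : cd_state) : bool :=
  match z1, z2 with
  | Bot, _ => true
  | _, Top => true
  | Val v, Val w => v == w
  | _, _ => false
  end.

Definition cd_join (z1 z2 : cd_state) : cd_state :=
  match z1, z2 with
  | Bot, z => z
  | z, Bot => z
  | Val v, Val w => if v == w then Val v else Top
  | _, _ => Top
  end.

Lemma cd_le_refl : reflexive cd_le.
Proof. by case=> [|v|] /=. Qed.

Lemma cd_le_anti : antisymmetric cd_le.
Proof. by move=> [|v|] [|w|] //= /andP[/eqP-> _]. Qed.

Lemma cd_le_trans : transitive cd_le.
Proof. by move=> [|v|] [|w|] [|u|] //= /eqP->. Qed.

Fact cd_display : Order.disp_t. Proof. exact: Order.Disp tt tt. Qed.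

HB.instance Definition _ := Order.Le_isPOrder.Build cd_display cd_state
  cd_le_refl cd_le_anti cd_le_trans.

(* [cd_join] is the least upper bound for [cd_le]. *)
Lemma cd_joinP (x y z : cd_state) :
  (cd_join x y <= z) = (x <= z) && (y <= z).
Proof.
rewrite !/(_ <= _)%O /=; case: x y z => [|v|] [|w|] [|u|] //=;
  rewrite ?andbT ?andbF //; have [->|vw] := eqVneq v w; rewrite ?andbb //=.
by apply/esym/negbTE/negP => /andP[/eqP vu /eqP wu]; rewrite vu wu eqxx in vw.
Qed.

HB.instance Definition _ :=
  Order.POrder_isJoinSemilattice.Build cd_display cd_state cd_joinP.

Lemma cd_le0 (z : cd_state) : Bot <= z. Proof. by []. Qed.

HB.instance Definition _ := Order.hasBottom.Build cd_display cd_state cd_le0.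

Definition cd_tau (z : cd_state) (a : cd_in) : cd_state :=
  let: check v := a in if (z == Bot) || (z == Val v) then Val v else Top.

Definition cd_delta (z : cd_state) (_ : cd_in) : bool := z == Top.

Definition CD : ladt :=
  @LADT cd_in bool cd_display cd_state Bot cd_tau cd_delta.

Variables P Id : choiceType.

Definition conflict_detecting (H : history P Id cd_in bool) : Prop :=
  ((forall l1 l2 v1 v2,
       inv_ev l1 (check v1) \in H -> inv_ev l2 (check v2) \in H ->
       v1 = v2) ->
   forall l, res_ev l true \notin H) /\
  (forall l1 l2 v1 v2,
     inv_ev l1 (check v1) \in H -> inv_ev l2 (check v2) \in H ->
     v1 <> v2 ->
     ~ (res_ev l1 false \in H /\ res_ev l2 false \in H)).

Definition conflict_detector (X : implementation P Id CD) : Prop :=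
  forall e : execution X, conflict_detecting (history_of e).

End ConflictDetector.

(* Main.v *)
(** In an interval-sequential execution of CD the states increase, since
    [z <= tau z a], and once [check v] has been invoked the state lies above
    [v].  If all inputs agree, the states never leave [{Bot, v}], so [Top] and
    hence the output [true] are never reached.  If [check v1] and [check v2] are
    invoked in blocks [j1 <= j2] and the second one responds in block [i2], then
    [j1 <= j2 <= i2], so [z_i2] is above both [v1] and [v2], hence it is [Top]
    and the second operation returns [true]. *)
Require Import Defs.
From mathcomp Require Import all_boot all_order finmap.
Set Implicit Arguments.
Unset Strict Implicit.
Unset Printing Implicit Defensive.
Import Order.TTheory.
Local Open Scope order_scope.

Section HistoryFacts.
Variables (P Id A B : choiceType).
Implicit Types (H : history P Id A B) (l : label P Id).

(** Each event lies in the projection on its own process, so the projections determine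
    membership. *)
Lemma eq_mem_proj H1 H2 : (forall p, proj p H1 = proj p H2) -> H1 =i H2.
Proof.
move=> eqH e.
have memE H : (e \in H) = (e \in proj (event_label e).1 H).
  by rewrite mem_filter eqxx.
by rewrite memE eqH -memE.
Qed.

Lemma mem_inv_labels H l a : inv_ev l a \in H -> l \in inv_labels H.
Proof. by move=> laH; rewrite mem_pmap; apply/mapP; exists (inv_ev l a). Qed.

(** Since no label is invoked twice, the label of an operation determines its input. *)
Lemma inv_ev_inj H l a1 a2 : uniq (inv_labels H) ->
  inv_ev l a1 \in H -> inv_ev l a2 \in H -> a1 = a2.
Proof.
elim: H => [|e H IH] //=; rewrite !in_cons.
case: e => [[l' a]|r] /= uH; last by move=> h1 h2; apply: IH.
case/andP: uH => l'H uH /orP[/eqP[El1 E1]|h1] /orP[/eqP[El2 E2]|h2].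
- by rewrite E1 E2.
- by rewrite -El1 (mem_inv_labels h2) in l'H.
- by rewrite -El2 (mem_inv_labels h1) in l'H.
- exact: IH.
Qed.

(** A completion appends responses only, so the inputs in play stay the same. *)
Lemma completion_inv H H' l a :
  completion H H' -> (inv_ev l a \in H') = (inv_ev l a \in H).
Proof.
case=> rs [-> _ _]; rewrite mem_cat; case: (_ \in H) => //=.
by apply/negbTE/mapP => -[].
Qed.

Lemma completion_sub H H' : completion H H' -> {subset H <= H'}.
Proof. by case=> rs [-> _ _] e eH; rewrite mem_cat eH. Qed.

Variable Z : Type.
Implicit Type S : iseq_history P Id A B Z.

(** Outside this range, including the padding index 0, the set is the default [fset0]. *)
Lemma iseq_inv_index S j i :
  i \in iseq_inv S j -> (1 <= j <= size (iseq_blocks S))%N.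
Proof.
case: j => [|j] //; rewrite /iseq_inv /=.
by case: (ltnP j (size (iseq_blocks S))) => // le; rewrite nth_default ?size_map.
Qed.

Lemma iseq_res_index S j r :
  r \in iseq_res S j -> (1 <= j <= size (iseq_blocks S))%N.
Proof.
case: j => [|j] //; rewrite /iseq_res /=.
by case: (ltnP j (size (iseq_blocks S))) => // le; rewrite nth_default ?size_map.
Qed.

Lemma mem_iseq_inv S l a :
  inv_ev l a \in iseq_events S <-> exists j, (l, a) \in iseq_inv S j.
Proof.
rewrite /iseq_events /iseq_inv; split; last first.
  move=> [[|j]] //= h; have := @iseq_inv_index S j.+1 _ h; rewrite ltnS => /= lt.
  elim: (iseq_blocks S) j h lt => [|b bs IH] [|j] //= h lt; rewrite !mem_cat.
    by apply/orP; left; apply/orP; left; apply/mapP; exists (l, a).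
  by rewrite (IH j) ?orbT.
elim: (iseq_blocks S) => [|b bs IH] //=; rewrite !mem_cat.
case/orP => [/orP[/mapP[x xb [->]]|/mapP[] //]|/IH[[|j] h] //].
  by exists 1%N.
(* Index 0 of the tail is empty padding; its index [j.+1] moves to [j.+2] behind the new block. *)
by exists j.+2.
Qed.

Lemma mem_iseq_res S l b :
  res_ev l b \in iseq_events S -> exists j, (l, b) \in iseq_res S j.
Proof.
rewrite /iseq_events /iseq_res.
elim: (iseq_blocks S) => [|c bs IH] //=; rewrite !mem_cat.
case/orP => [/orP[/mapP[] //|/mapP[x xb [->]]]|/IH[[|j] h] //].
  by exists 1%N.
by exists j.+2.
Qed.

End HistoryFacts.

Section ConflictDetectorStates.
Variables (V : countType) (P Id : choiceType).
Implicit Type S : ladt_iseq_history P Id (CD V).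

Lemma cd_tau_ge (z : cd_state V) a : z <= cd_tau z a.
Proof.
case: a => v; rewrite /cd_tau; case: z => [|w|] //=.
by case: eqP => [[->]|] //; exact: lexx.
Qed.

Lemma cd_tau_ge_val (z : cd_state V) v : Val v <= cd_tau z (check v).
Proof. by rewrite /cd_tau; case: ifP => // _; exact: lexx. Qed.

(** Distinct values are incomparable, so [Top] is their only common upper bound. *)
Lemma cd_join2_top (z : cd_state V) v1 v2 :
  v1 <> v2 -> Val v1 <= z -> Val v2 <= z -> z = Top V.
Proof.
by case: z => [|w|] //= ne /eqP E1 /eqP E2; case: ne; rewrite E1 E2.
Qed.

Lemma next_state_ge_tau z (I : {fset invocation P Id (cd_in V)}) x :
  x \in I -> cd_tau z x.2 <= @next_state P Id (CD V) z I.
Proof.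
move=> xI; rewrite /next_state; case: eqP => [I0|_]; first by rewrite I0 in xI.
exact: (@joins_sup_seq _ (cd_state V) _ _ xpredT (fun y => cd_tau z y.2)).
Qed.

Lemma next_state_ge z (I : {fset invocation P Id (cd_in V)}) :
  z <= @next_state P Id (CD V) z I.
Proof.
have [->|/fset0Pn[x xI]] := eqVneq I fset0.
  by rewrite /next_state eqxx; exact: lexx.
exact: le_trans (cd_tau_ge z x.2) (next_state_ge_tau _ xI).
Qed.

Lemma iseq_state_le S i j : iseq_spec S ->
  (i <= j <= size (iseq_blocks S))%N -> iseq_state S i <= iseq_state S j.
Proof.
case=> _ _ step /andP[]; elim: j => [|j IH].
  by rewrite leqn0 => /eqP-> _; exact: lexx.
rewrite leq_eqVlt => /orP[/eqP-> _|ij jS]; first exact: lexx.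
apply: le_trans (IH ij (ltnW jS)) _.
by have [-> _] := step j.+1 jS; exact: next_state_ge.
Qed.

(** Block [j] already lifts the state above [Val v], and monotonicity carries this on to block
    [i]. *)
Lemma iseq_state_ge_val S i j l v : iseq_spec S ->
  (l, check v) \in iseq_inv S j -> (j <= i <= size (iseq_blocks S))%N ->
  Val v <= iseq_state S i.
Proof.
move=> specS lj ji; apply: le_trans (iseq_state_le specS ji).
have [-> _] : _ /\ _ := let: And3 _ _ step := specS in step _ (iseq_inv_index lj).
exact: le_trans (cd_tau_ge_val _ v) (next_state_ge_tau _ lj).
Qed.

(* Stated without fixing the common input [v], which need not exist when no
   operation is invoked. *)
Lemma iseq_state_le_common S i : iseq_spec S ->
  (forall l1 l2 v1 v2, inv_ev l1 (check v1) \in iseq_events S ->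
     inv_ev l2 (check v2) \in iseq_events S -> v1 = v2) ->
  (i <= size (iseq_blocks S))%N ->
  iseq_state S i = Bot V \/
  exists l v, inv_ev l (check v) \in iseq_events S /\ iseq_state S i = Val v.
Proof.
move=> [_ init step] same; elim: i => [|i IH] iS; first by left.
have [-> _] := step i.+1 iS; rewrite /next_state.
(* An empty block keeps the state; in a nonempty one any invocation can serve as the witness. *)
case: (eqVneq (iseq_inv S i.+1)) => [_|/fset0Pn[[l [v]] lI]]; first exact/IH/ltnW.
have lS : inv_ev l (check v) \in iseq_events S by apply/mem_iseq_inv; exists i.+1.
right; exists l, v; split=> //.
apply: (@le_anti _ (cd_state V)); apply/andP; split; last first.
  apply: le_trans (@joins_sup_seq _ (cd_state V) _ _ xpredT
    (fun y => cd_tau (iseq_state S i) y.2) _ lI isT).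
  exact: cd_tau_ge_val.
(* Every input of the block is [check v] and the previous state is [Bot] or [Val v], so every joined
   term is [Val v]. *)
apply/(@joinsP_seq _ (cd_state V)) => -[l' [v']] lI' _ /=.
have lS' : inv_ev l' (check v') \in iseq_events S.
  by apply/mem_iseq_inv; exists i.+1.
rewrite (same _ _ _ _ lS' lS) /cd_tau.
have [->|[m [w [mS ->]]]] := IH (ltnW iS); first exact: lexx.
by rewrite (same _ _ _ _ mS lS) eqxx orbT; exact: lexx.
Qed.

(** The output [cd_delta] depends on the state alone, so the response reveals whether that state is
    [Top]. *)
Lemma iseq_res_delta S l b : iseq_spec S -> res_ev l b \in iseq_events S ->
  exists i j a, [/\ (j <= i <= size (iseq_blocks S))%N,
    (l, a) \in iseq_inv S j & b = (iseq_state S i == Top V)].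
Proof.
move=> [_ _ step] /mem_iseq_res[i lb].
have iS := iseq_res_index lb; have [_ /(_ _ _ lb)[a [j [ji la ->]]]] := step i iS.
by exists i, j, a; case/andP: iS => _ ->; rewrite ji.
Qed.

Lemma iseq_res_false S l v :
  iseq_spec S -> inv_ev l (check v) \in iseq_events S ->
  res_ev l false \in iseq_events S ->
  exists i j, [/\ (j <= i <= size (iseq_blocks S))%N,
    (l, check v) \in iseq_inv S j & iseq_state S i <> Top V].
Proof.
move=> specS lS /(iseq_res_delta specS)[i [j [a [ji la zi]]]].
have [[uS _] _ _] := specS.
have laS : inv_ev l a \in iseq_events S by apply/mem_iseq_inv; exists j.
(* The specification only provides some matching input [a]; uniqueness of labels identifies it with
   [check v]. *)
exists i, j; split=> //; first by rewrite (inv_ev_inj uS lS laS).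
by move=> zT; rewrite zT eqxx in zi.
Qed.

Lemma iseq_conflict_detecting S :
  iseq_spec S -> conflict_detecting (iseq_events S).
Proof.
move=> specS; split=> [same l|l1 l2 v1 v2 h1 h2 ne [r1 r2]].
  apply/negP => /(iseq_res_delta specS)[i [j [a [/andP[_ iS] _]]]].
  by have [->|[m [w [_ ->]]]] := iseq_state_le_common specS same iS.
have [i1 [j1 [/andP[ji1 iS1] lj1 zi1]]] := iseq_res_false specS h1 r1.
have [i2 [j2 [/andP[ji2 iS2] lj2 zi2]]] := iseq_res_false specS h2 r2.
(* The contradiction comes from the operation whose invocation block is the later one: its response
   block follows both invocations. *)
case/orP: (leq_total j1 j2) => j12; [apply: zi2|apply: zi1];
  apply: (cd_join2_top ne); [apply: iseq_state_ge_val specS lj1 _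
  | apply: iseq_state_ge_val specS lj2 _ | apply: iseq_state_ge_val specS lj1 _
  | apply: iseq_state_ge_val specS lj2 _]; apply/andP; split=> //;
  exact: leq_trans j12 _.
Qed.

End ConflictDetectorStates.

Theorem theorem6p3 (V : countType) (P Id : choiceType)
    (X : implementation P Id (CD V)) :
  interval_linearizable_impl X -> conflict_detector X.
Proof.
move=> linX e; have [H' [S [HH' projS specS _]]] := linX e.
have eqS := eq_mem_proj projS.
have invS l a : (inv_ev l a \in iseq_events S) = (inv_ev l a \in history_of e).
  by rewrite -eqS (completion_inv _ _ HH').
(* Only one direction holds for responses, since the completion may have added some. *)
have resS l b : res_ev l b \in history_of e -> res_ev l b \in iseq_events S.
  by move=> h; rewrite -eqS (completion_sub HH' h).
have [det1 det2] := iseq_conflict_detecting specS.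
split=> [same l|l1 l2 v1 v2 h1 h2 ne [r1 r2]].
  apply/negP => /resS; apply/negP/det1 => l1 l2 v1 v2 h1 h2.
  by apply: (same l1 l2); rewrite -invS.
by apply: (det2 l1 l2 v1 v2) => //; [rewrite invS | rewrite invS | split; exact: resS].
Qed.
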